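(* Let $\langle X, \phi \rangle$ be a finite closure system, let $E_1, \dots, E_n$ be the essential sets of $\langle X, \phi \rangle$, and let $\Sigma_1, \dots, \Sigma_n$ be implication bases for $\langle X, \phi \rangle$. For each $i$, let $\Sigma_i' = \{(A \rightarrow B) \in \Sigma_i : \phi(A) = E_i\}$. Let $\Sigma = \bigcup_{i=1}^n \Sigma_i'$. Then $\Sigma$ is an implication basis for $\langle X, \phi \rangle$.
   Context: A closure system $\langle X, \phi \rangle$ is a nonempty set $X$ equipped with a closure operator $\phi: \mathcal{P}(X) \to \mathcal{P}(X)$, i.e. a map such that for all $A, B \subseteq X$: $A \subseteq \phi(A)$; $A \subseteq B$ implies $\phi(A) \subseteq \phi(B)$; and $\phi(\phi(A)) = \phi(A)$. It is finite if $X$ is finite. A set $A \subseteq X$ is closed if $A = \phi(A)$; let $F$ denote the family of closed sets, which contains $X$ and is closed under intersection. An implication on $X$ is an ordered pair of sets $A, B \subseteq X$, denoted $A \rightarrow B$. A set $S \subseteq X$ obeys $A \rightarrow B$ if $A \not\subseteq S$ or $B \subseteq S$. A set $\Sigma$ of implications on $X$ is an implication basis for $\langle X, \phi \rangle$ if the family of subsets of $X$ that obey all implications in $\Sigma$ is exactly the family $F$ of closed sets of $\langle X, \phi \rangle$. A set $Q \subseteq X$ is quasi-closed (associated with $\langle X, \phi \rangle$) if $Q \notin F$ and $F \cup \{Q\}$ is still closed under set intersection, i.e. for every $S \in F$, $S \supseteq Q$ or $S \cap Q \in F$. An essential set of $\langle X, \phi \rangle$ is a set of the form $\phi(Q)$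 with $Q$ quasi-closed; $E_1, \dots, E_n$ is the list of all distinct essential sets. *)

(* Defs.v *)
From mathcomp Require Import all_boot.

Set Implicit Arguments.
Unset Strict Implicit.
Unset Printing Implicit Defensive.

(* The pair (A, B) encodes A -> B; X being finite, every set of implications
   on X is a {set implication X}. *)
Notation implication X := ({set X} * {set X})%type.

Section ClosureSystems.

Variable X : finType.
Implicit Types (A B S Q : {set X}) (F : {set {set X}}).

Record closure_operator (phi : {set X} -> {set X}) : Prop := ClosureOperator {
  closure_extensive : forall A, A \subset phi A;
  closure_monotone : forall A B, A \subset B -> phi A \subset phi B;
  closure_idempotent : forall A, phi (phi A) = phi A }.

Definition closed_sets (phi : {set X} -> {set X}) : {set {set X}} :=
  [set A | A == phi A].

Definition obeys S (i : implication X) : bool :=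
  ~~ (i.1 \subset S) || (i.2 \subset S).

Definition implication_basis (phi : {set X} -> {set X})
    (Sigma : {set implication X}) : Prop :=
  [set S | [forall i in Sigma, obeys S i]] = closed_sets phi.

Definition intersection_closed F : bool :=
  [forall A in F, forall B in F, A :&: B \in F].

Definition quasi_closed (phi : {set X} -> {set X}) Q : bool :=
  (Q \notin closed_sets phi) && intersection_closed (Q |: closed_sets phi).

Definition essential_sets (phi : {set X} -> {set X}) : {set {set X}} :=
  [set phi Q | Q in quasi_closed phi].

Lemma closed_setsI (phi : {set X} -> {set X}) A B :
  closure_operator phi -> A \in closed_sets phi -> B \in closed_sets phi ->
  A :&: B \in closed_sets phi.
Proof.
case=> ext mono _; rewrite !inE => /eqP cA /eqP cB.
rewrite eqEsubset ext subsetI {2}cA {3}cB.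
by rewrite !mono ?subsetIl ?subsetIr.
Qed.

Lemma quasi_closedP (phi : {set X} -> {set X}) Q :
  closure_operator phi ->
  reflect (Q \notin closed_sets phi /\
           forall S, S \in closed_sets phi ->
             Q \subset S \/ S :&: Q \in closed_sets phi)
          (quasi_closed phi Q).
Proof.
move=> cl; apply: (iffP andP) => -[nQ H]; split=> //.
  move=> S cS; move/forall_inP: H => /(_ S) /[!(setU1r, cS)] // /(_ isT).
  move=> /forall_inP /(_ Q (setU11 _ _)); rewrite in_setU1.
  by case/predU1P=> [<-|]; [left; apply: subsetIl | right].
have aux S : S \in closed_sets phi -> S :&: Q \in Q |: closed_sets phi.
  by move=> /H [/setIidPr ->|SQ]; [apply: setU11 | apply: setU1r].
apply/forall_inP => A /setU1P [->|cA]; apply/forall_inP => B /setU1P [->|cB].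
- by rewrite setIid setU11.
- by rewrite setIC aux.
- exact: aux.
- by rewrite setU1r // closed_setsI.
Qed.

End ClosureSystems.

(* Main.v *)
Require Import Defs.
From mathcomp Require Import all_boot.

(** A closed set obeys every implication of every basis, so only the converse
    needs an idea: a set [S] that is not closed must violate an implication
    whose premise has essential closure and which comes from the basis attached
    to that essential set.  Among the subsets of [S] whose closure sticks out
    of [S], take one with the smallest closure [C].  By minimality the trace
    [Q] of [S] on [C] is quasi-closed and has closure [C]
    ([quasi_closed_trace]), so [C] is one of the essential sets [E i].

    As [Q] is not closed, it violates some [A -> B] of [Sigma i].  The closed
    set [C] obeys it, hence [B] lies in [C], and since [B] is not inside
    [Q = S :&: C], it is not inside [S].  If the closure of [A] were strictly
    smaller than [C], minimality would put it inside [S], and then [B], which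
    is contained in the closure of [A], would be inside [S] as well.  So the
    closure of [A] is [E i]: the implication survives in the union, and [S]
    violates it. *)

Section Closure.

Set Implicit Arguments.
Unset Strict Implicit.

Variables (X : finType) (phi : {set X} -> {set X}).
Hypothesis phi_closure : closure_operator phi.
Implicit Types (A S Q : {set X}).

Lemma closed_setP S : reflect (phi S \subset S) (S \in closed_sets phi).
Proof.
rewrite inE eqEsubset (closure_extensive phi_closure).
exact: idP.
Qed.

Lemma closure_closed A : phi A \in closed_sets phi.
Proof. by rewrite inE (closure_idempotent phi_closure). Qed.

Lemma closure_min A S :
  S \in closed_sets phi -> A \subset S -> phi A \subset S.
Proof.
by move=> /closed_setP cS /(closure_monotone phi_closure) /subset_trans; apply.
Qed.

(** The set [Q] is the trace of [S] on the smallest closure [phi A], [A] inside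
    [S], that is not inside [S].  A closed set that does not contain [Q] cuts
    out of [Q] a piece of strictly smaller closure; that closure stays inside
    [S] by minimality, so the piece is closed.  The last clause keeps
    the minimality: it rules out that an implication violated by [Q] has a
    premise of smaller closure than [Q]. *)
Lemma quasi_closed_trace S :
  S \notin closed_sets phi ->
  exists Q, [/\ quasi_closed phi Q, Q = S :&: phi Q
    & forall A, A \subset S -> phi A \proper phi Q -> phi A \subset S].
Proof.
have ext := closure_extensive phi_closure.
move/closed_setP/negP => SnS.
have PS : (S \subset S) && ~~ (phi S \subset S) by rewrite subxx.
case: (arg_minnP (P := fun A => (A \subset S) && ~~ (phi A \subset S))
         (fun A => #|phi A|) PS) => A0 /andP [A0S nA0] minA0.
have small A : A \subset S -> phi A \proper phi A0 -> phi A \subset S.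
  move=> AS ltA; apply: contraLR (proper_card ltA) => nA.
  by rewrite -leqNgt minA0 // AS.
have phiQ : phi (S :&: phi A0) = phi A0.
  apply/eqP; rewrite eqEsubset closure_min ?subsetIr ?closure_closed //=.
  by rewrite (closure_monotone phi_closure) // subsetI A0S ext.
exists (S :&: phi A0); rewrite phiQ; split=> //.
apply/quasi_closedP => //; split=> [|T cT].
  apply: contra nA0 => /closed_setP; rewrite phiQ subsetI.
  by case/andP.
have [QT|nQT] := boolP (S :&: phi A0 \subset T); [by left | right].
set Q := S :&: phi A0 in phiQ nQT *.
have TQ_T : phi (T :&: Q) \subset T by rewrite closure_min ?subsetIl.
have TQ_A0 : phi (T :&: Q) \subset phi A0.
  by rewrite -phiQ (closure_monotone phi_closure) ?subsetIr.
apply/closed_setP; rewrite !subsetI TQ_T TQ_A0 andbT.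
apply: small.
  by apply: subset_trans (subsetIr _ _) _; apply: subsetIl.
rewrite properE TQ_A0; apply: contra nQT => A0TQ.
exact: subset_trans (subsetIr _ _) (subset_trans A0TQ TQ_T).
Qed.

Lemma basis_closedP (Sigma : {set implication X}) S :
  implication_basis phi Sigma ->
  reflect (forall i, i \in Sigma -> obeys S i) (S \in closed_sets phi).
Proof. by move=> <-; rewrite inE; apply: forall_inP. Qed.

(** The quantifiers come in this order because the essential set depends on [S]
    and [phi] alone.  The basis searched for a violated implication can thus be
    the one attached to that essential set, which is what makes it possible to
    mix several bases. *)
Lemma nonclosed_violates S :
  S \notin closed_sets phi ->
  exists2 C, C \in essential_sets phi
    & forall Sigma, implication_basis phi Sigma ->
      exists AB, [/\ AB \in Sigma, phi AB.1 = C & ~~ obeys S AB].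
Proof.
move=> /quasi_closed_trace [Q [qQ defQ small]].
exists (phi Q); first exact: imset_f.
move=> Sigma basis.
have /(quasi_closedP _ phi_closure) [nQ _] := qQ.
have /exists_inP [AB ABin] : [exists AB in Sigma, ~~ obeys Q AB].
  rewrite -negb_forall_in; apply: contra nQ => /forall_inP.
  by move/(basis_closedP _ basis).
rewrite /obeys negb_or negbK => /andP [AQ nBQ].
have ext := closure_extensive phi_closure.
have AS : AB.1 \subset S by apply: subset_trans AQ _; rewrite defQ subsetIl.
have closureB T : AB.1 \subset phi T -> AB.2 \subset phi T.
  move=> AT; have /(basis_closedP _ basis) /(_ _ ABin) := closure_closed T.
  by rewrite /obeys AT.
have nBS : ~~ (AB.2 \subset S).
  apply: contra nBQ => BS; rewrite defQ subsetI BS closureB //.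
  exact: subset_trans AQ (ext Q).
exists AB; split=> //; last by rewrite AS.
apply/eqP; apply: contraR nBS => neqA.
apply: subset_trans (closureB _ (ext _)) _; apply: small => //.
by rewrite properEneq neqA (closure_monotone phi_closure).
Qed.

End Closure.

Theorem theorem3 (X : finType) (phi : {set X} -> {set X})
    (X_nonempty : 0 < #|X|) (phi_closure : closure_operator phi)
    (n : nat) (E : 'I_n -> {set X}) (E_distinct : injective E)
    (E_essential : forall S : {set X},
      S \in essential_sets phi <-> exists i : 'I_n, S = E i)
    (Sigma : 'I_n -> {set implication X})
    (Sigma_basis : forall i : 'I_n, implication_basis phi (Sigma i)) :
  implication_basis phi
    (\bigcup_(i < n) [set AB in Sigma i | phi AB.1 == E i]).
Proof.
apply/setP => S; rewrite [LHS]inE; apply/forall_inP/idP => [obeyS | cS AB].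
  apply/negPn/negP => /(nonclosed_violates phi_closure) [C].
  move=> /E_essential [i ->] /(_ _ (Sigma_basis i)) [AB [ABin phiA /negP]].
  by apply; apply: obeyS; apply/bigcupP; exists i; rewrite // inE ABin phiA /=.
case/bigcupP => i _; rewrite inE => /andP [ABin _].
exact: (basis_closedP _ (Sigma_basis i) cS).
Qed.
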